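(* Let $\mathscr{A}\in\mathbb{R}^{I_1\times\cdots\times I_M\times I_1\times\cdots\times I_M}$, $\mathscr{C}\in\mathbb{R}^{J_1\times\cdots\times J_N\times J_1\times\cdots\times J_N}$ and $\mathscr{D},\mathscr{X}_0\in\mathbb{R}^{I_1\times\cdots\times I_M\times J_1\times\cdots\times J_N}$, and suppose that the Sylvester tensor equation $\mathscr{A}*_M\mathscr{X}+\mathscr{X}*_N\mathscr{C}=\mathscr{D}$ is consistent, i.e. has a solution $\mathscr{X}\in\mathbb{R}^{I_1\times\cdots\times I_M\times J_1\times\cdots\times J_N}$. Then the tensor nearness problem $$\min_{\mathscr{A}*_M\mathscr{X}+\mathscr{X}*_N\mathscr{C}=\mathscr{D}}\|\mathscr{X}-\mathscr{X}_0\|$$ has a unique solution $\widehat{\mathscr{X}}$. Moreover $\widehat{\mathscr{X}}=\widehat{\mathscr{Y}}+\mathscr{X}_0$, where $\widehat{\mathscr{Y}}$ is the least Frobenius norm solution of the Sylvester tensor equation $\mathscr{A}*_M\mathscr{Y}+\mathscr{Y}*_N\mathscr{C}=\widetilde{\mathscr{D}}$ with $\widetilde{\mathscr{D}}=\mathscr{D}-\mathscr{A}*_M\mathscr{X}_0-\mathscr{X}_0*_N\mathscr{C}$; and $\widehat{\mathscr{Y}}$ is obtained within finitely many iteration steps, in exact arithmetic, by applying Algorithm G (defined in the context) to this equation (i.e. with input $\mathscr{A},\mathscr{C},\widetilde{\mathscr{D}}$) with initial iteration tensor $\mathscr{A}^T*_M\mathscr{W}+\mathscr{W}*_N\mathscr{C}^T$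 for any $\mathscr{W}\in\mathbb{R}^{I_1\times\cdots\times I_M\times J_1\times\cdots\times J_N}$ (or, especially, with the zero tensor as initial iteration tensor).
   Context: Einstein product: for $\mathscr{A}\in\mathbb{R}^{I_1\times\cdots\times I_M\times J_1\times\cdots\times J_N}$ and $\mathscr{B}\in\mathbb{R}^{J_1\times\cdots\times J_N\times K_1\times\cdots\times K_L}$, $(\mathscr{A}*_N\mathscr{B})_{i_1\dots i_Mk_1\dots k_L}=\sum_{j_1,\dots,j_N}\mathscr{A}_{i_1\dots i_Mj_1\dots j_N}\mathscr{B}_{j_1\dots j_Nk_1\dots k_L}$; the subscript of $*$ is the number of contracted modes. Transpose: for $\mathscr{A}\in\mathbb{R}^{I_1\times\cdots\times I_M\times J_1\times\cdots\times J_N}$, $\mathscr{A}^T\in\mathbb{R}^{J_1\times\cdots\times J_N\times I_1\times\cdots\times I_M}$ with $(\mathscr{A}^T)_{j_1\dots j_Ni_1\dots i_M}=\mathscr{A}_{i_1\dots i_Mj_1\dots j_N}$. $\|\cdot\|$ is the Frobenius norm (square root of the sum of squares of all entries). Algorithm G for an equation $\mathscr{A}*_M\mathscr{X}+\mathscr{X}*_N\mathscr{C}=\mathscr{E}$ (input $\mathscr{A},\mathscr{C},\mathscr{E}$ and an initial tensor $\mathscr{X}^{(1)}$): set $\mathscr{R}^{(1)}=\mathscr{E}-\mathscr{A}*_M\mathscr{X}^{(1)}-\mathscr{X}^{(1)}*_N\mathscr{C}$ and $\mathscr{P}^{(1)}=\mathscr{A}^T*_M\mathscr{R}^{(1)}+\mathscr{R}^{(1)}*_N\mathscr{C}^T$.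 For $k=1,2,\dots$: if $\mathscr{R}^{(k)}=0$, or if $\mathscr{R}^{(k)}\ne0$ and $\mathscr{P}^{(k)}=0$, stop; otherwise set $$\mathscr{X}^{(k+1)}=\mathscr{X}^{(k)}+\frac{\|\mathscr{R}^{(k)}\|^2}{\|\mathscr{P}^{(k)}\|^2}\mathscr{P}^{(k)},\qquad \mathscr{R}^{(k+1)}=\mathscr{E}-\mathscr{A}*_M\mathscr{X}^{(k+1)}-\mathscr{X}^{(k+1)}*_N\mathscr{C},$$ $$\mathscr{P}^{(k+1)}=\mathscr{A}^T*_M\mathscr{R}^{(k+1)}+\mathscr{R}^{(k+1)}*_N\mathscr{C}^T+\frac{\|\mathscr{R}^{(k+1)}\|^2}{\|\mathscr{R}^{(k)}\|^2}\mathscr{P}^{(k)}.$$ The solution obtained by the algorithm is the iterate $\mathscr{X}^{(k)}$ at which it stops with $\mathscr{R}^{(k)}=0$. *)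

(* Defs.v *)
From HB Require Import structures.
From mathcomp Require Import all_boot all_order all_algebra.
From mathcomp Require Import reals.
Set Implicit Arguments.
Unset Strict Implicit.
Unset Printing Implicit Defensive.
Import GRing.Theory.
Local Open Scope ring_scope.

(* Multi-indices (i_1, ..., i_M) with i_m ranging over a set of size I m. *)
Definition midx (M : nat) (I : 'I_M -> nat) : Type :=
  {dffun forall m : 'I_M, 'I_(I m)}.

HB.instance Definition _ (M : nat) (I : 'I_M -> nat) :=
  Finite.copy (midx I) {dffun forall m : 'I_M, 'I_(I m)}.

(* R^{I_1 x ... x I_M x J_1 x ... x J_N}: the M + N indices are kept as a pair
   of multi-indices, so the number of modes contracted by the Einstein product
   is read off from the types.  R^o is R seen as a module over itself, which
   gives tensors their entrywise scaling *:. *)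
Definition tensor (R : realType) (M N : nat)
    (I : 'I_M -> nat) (J : 'I_N -> nat) : Type :=
  {ffun midx I * midx J -> R^o}.

HB.instance Definition _ (R : realType) (M N : nat)
    (I : 'I_M -> nat) (J : 'I_N -> nat) :=
  GRing.Lmodule.copy (tensor R I J) {ffun midx I * midx J -> R^o}.

Definition einstein (R : realType) (M N L : nat)
    (I : 'I_M -> nat) (J : 'I_N -> nat) (K : 'I_L -> nat)
    (A : tensor R I J) (B : tensor R J K) : tensor R I K :=
  [ffun ik => \sum_(j : midx J) (A (ik.1, j) : R) * B (j, ik.2)].

Notation "A *E B" := (einstein A B)
  (at level 40, left associativity) : ring_scope.

Definition ttr (R : realType) (M N : nat) (I : 'I_M -> nat) (J : 'I_N -> nat)
    (A : tensor R I J) : tensor R J I :=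
  [ffun ji => A (ji.2, ji.1)].

Definition fnorm (R : realType) (M N : nat) (I : 'I_M -> nat) (J : 'I_N -> nat)
    (A : tensor R I J) : R :=
  Num.sqrt (\sum_(ij : midx I * midx J) (A ij : R) ^+ 2).

Definition sylvester_solution (R : realType) (M N : nat)
    (I : 'I_M -> nat) (J : 'I_N -> nat) (A : tensor R I I) (C : tensor R J J)
    (E X : tensor R I J) : Prop :=
  A *E X + X *E C = E.

Definition is_minimizer (T : Type) (R : realType) (S : T -> Prop) (f : T -> R)
    (x : T) : Prop :=
  S x /\ forall y, S y -> f x <= f y.

Definition nearness_solution (R : realType) (M N : nat)
    (I : 'I_M -> nat) (J : 'I_N -> nat) (A : tensor R I I) (C : tensor R J J)
    (D X0 X : tensor R I J) : Prop :=
  is_minimizer (sylvester_solution A C D) (fun Z => fnorm (Z - X0)) X.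

Definition least_norm_solution (R : realType) (M N : nat)
    (I : 'I_M -> nat) (J : 'I_N -> nat) (A : tensor R I I) (C : tensor R J J)
    (E Y : tensor R I J) : Prop :=
  is_minimizer (sylvester_solution A C E) (fun Z => fnorm Z) Y.

Record algG_state (R : realType) (M N : nat)
    (I : 'I_M -> nat) (J : 'I_N -> nat) := AlgGState {
  stX : tensor R I J;
  stR : tensor R I J;
  stP : tensor R I J
}.

Definition algG_init (R : realType) (M N : nat)
    (I : 'I_M -> nat) (J : 'I_N -> nat) (A : tensor R I I) (C : tensor R J J)
    (E X1 : tensor R I J) : algG_state R I J :=
  let R1 := E - A *E X1 - X1 *E C in
  AlgGState X1 R1 (ttr A *E R1 + R1 *E ttr C).

(* [None] means that the algorithm stops at the given state. *)
Definition algG_step (R : realType) (M N : nat)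
    (I : 'I_M -> nat) (J : 'I_N -> nat) (A : tensor R I I) (C : tensor R J J)
    (E : tensor R I J) (s : algG_state R I J) : option (algG_state R I J) :=
  let: AlgGState Xk Rk Pk := s in
  if (Rk == 0) || ((Rk != 0) && (Pk == 0)) then None
  else
    let X' := Xk + (fnorm Rk ^+ 2 / fnorm Pk ^+ 2) *: Pk in
    let R' := E - A *E X' - X' *E C in
    let P' := ttr A *E R' + R' *E ttr C
              + (fnorm R' ^+ 2 / fnorm Rk ^+ 2) *: Pk in
    Some (AlgGState X' R' P').

(* [algG_run A C E X1 k] is (X^(k+1), R^(k+1), P^(k+1)), or [None] if the
   algorithm has stopped before producing it. *)
Fixpoint algG_run (R : realType) (M N : nat)
    (I : 'I_M -> nat) (J : 'I_N -> nat) (A : tensor R I I) (C : tensor R J J)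
    (E X1 : tensor R I J) (k : nat) : option (algG_state R I J) :=
  if k is k'.+1 then obind (algG_step A C E) (algG_run A C E X1 k')
  else Some (algG_init A C E X1).

(* The algorithm stops, after finitely many steps, with zero residual and with
   Y as its current iterate. *)
Definition algG_obtains (R : realType) (M N : nat)
    (I : 'I_M -> nat) (J : 'I_N -> nat) (A : tensor R I I) (C : tensor R J J)
    (E X1 Y : tensor R I J) : Prop :=
  exists k s, [/\ algG_run A C E X1 k = Some s, stR s = 0 & stX s = Y].

(* Main.v *)
From HB Require Import structures.
Require Import Defs.
From mathcomp Require Import all_boot all_order all_algebra.
From mathcomp Require Import reals.
From mathcomp Require Import ring.
Import Order.TTheory GRing.Theory Num.Theory.
Local Open Scope ring_scope.
Set Implicit Arguments.
Unset Strict Implicit.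
Unset Printing Implicit Defensive.

(** The linear map L(X) = A * X + X * C on tensors has, for the Frobenius inner
    product, the adjoint Lt(X) = A^T * X + X * C^T ([dot_sylv]).

    A solution of L(Y) = E that lies in the range of Lt is orthogonal to the
    kernel of L, so by Pythagoras it is strictly shorter than every other
    solution ([range_adjoint_least_norm]); such a solution is therefore the
    least norm solution, and there is at most one of them.

    Algorithm G never leaves the range of Lt once started there
    ([iterate_in_range]), so it only remains to see that it reaches a zero
    residual.  For a consistent equation with solution X', the invariant
    <X' - X_k, P_k> = |R_k|^2 ([dot_error_direction]) rules out a breakdown
    P_k = 0 with R_k <> 0.  As in the conjugate gradient method, the residuals
    are pairwise orthogonal as long as they do not vanish
    ([residuals_directions_orthogonal]), and the finite-dimensional space of
    tensors holds no arbitrarily long family of nonzero orthogonal vectors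
    ([orthogonal_family_bound]).

    The nearness problem is the least norm problem translated by X0. *)

(** * The Frobenius inner product *)

Section FrobeniusInnerProduct.
Variables (R : realType) (M N : nat) (I : 'I_M -> nat) (J : 'I_N -> nat).
Implicit Types (X Y Z : tensor R I J) (a : R).

Definition dot X Y : R := \sum_ij (X ij : R) * Y ij.

Lemma dot_pair X Y : dot X Y = \sum_i \sum_j (X (i, j) : R) * Y (i, j).
Proof. by rewrite pair_bigA; apply: eq_bigr => -[]. Qed.

Lemma dotC X Y : dot X Y = dot Y X.
Proof. by apply: eq_bigr => ij _; rewrite mulrC. Qed.

Lemma dotDl X Y Z : dot (X + Y) Z = dot X Z + dot Y Z.
Proof. by rewrite -big_split; apply: eq_bigr => ij _; rewrite ffunE mulrDl. Qed.

Lemma dotZl a X Y : dot (a *: X) Y = a * dot X Y.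
Proof.
rewrite /dot mulr_sumr; apply: eq_bigr => ij _.
by rewrite ffunE -mulrA.
Qed.

Lemma dotNl X Y : dot (- X) Y = - dot X Y.
Proof. by rewrite -scaleN1r dotZl mulN1r. Qed.

Lemma dotBl X Y Z : dot (X - Y) Z = dot X Z - dot Y Z.
Proof. by rewrite dotDl dotNl. Qed.

Lemma dotDr X Y Z : dot Z (X + Y) = dot Z X + dot Z Y.
Proof. by rewrite !(dotC Z) dotDl. Qed.

Lemma dotZr a X Y : dot Y (a *: X) = a * dot Y X.
Proof. by rewrite !(dotC Y) dotZl. Qed.

Lemma dot0l X : dot 0 X = 0.
Proof. by rewrite -(subrr X) dotBl subrr. Qed.

Lemma dot0r X : dot X 0 = 0.
Proof. by rewrite dotC dot0l. Qed.

Lemma dot_ge0 X : 0 <= dot X X.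
Proof. by apply: sumr_ge0 => ij _; rewrite -expr2 sqr_ge0. Qed.

Lemma dot_eq0 X : (dot X X == 0) = (X == 0).
Proof.
apply/eqP/eqP => [dX0|->]; last exact: dot0l.
apply/ffunP => ij; rewrite ffunE; apply/eqP.
have sq_ge0 kl : true -> 0 <= (X kl : R) * X kl.
  by rewrite -expr2 sqr_ge0.
have /eqP := psumr_eq0P sq_ge0 dX0 (i := ij) isT.
by rewrite mulf_eq0 orbb.
Qed.

Lemma fnorm_sqr X : fnorm X ^+ 2 = dot X X.
Proof.
rewrite sqr_sqrtr; last by apply: sumr_ge0 => ij _; rewrite sqr_ge0.
by apply: eq_bigr => ij _; rewrite expr2.
Qed.

Lemma ler_fnorm X Y : (fnorm X <= fnorm Y) = (dot X X <= dot Y Y).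
Proof. by rewrite -!fnorm_sqr ler_sqr // nnegrE sqrtr_ge0. Qed.

(** The matrix whose rows are the vectors of the family has an invertible
    diagonal Gram matrix, hence has full row rank. *)
Lemma orthogonal_family_bound n (f : 'I_n -> tensor R I J) :
  (forall i, f i != 0) -> (forall i j, i != j -> dot (f i) (f j) = 0) ->
  (n <= #|{: midx I * midx J}|)%N.
Proof.
move=> f_neq0 f_orth.
pose B : 'M[R]_(n, #|{: midx I * midx J}|) :=
  \matrix_(i, k) f i (enum_val k).
have gramE : B *m B^T = diag_mx (\row_i dot (f i) (f i)).
  apply/matrixP => i j; rewrite !mxE.
  have -> : \sum_k B i k * B^T k j = dot (f i) (f j).
    rewrite /dot (big_enum_val (A := {: midx I * midx J})) /=.
    by apply: eq_bigr => k _; rewrite !mxE.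
  by case: eqVneq => [->|/f_orth ->]; rewrite ?mulr1n ?mulr0n.
have gram_unit : B *m B^T \in unitmx.
  rewrite gramE unitmxE det_diag unitfE.
  by apply/prodf_neq0 => i _; rewrite mxE dot_eq0.
rewrite -(mxrank_unit gram_unit).
exact: leq_trans (mxrankM_maxl _ _) (rank_leq_col _).
Qed.

End FrobeniusInnerProduct.

(** * The Sylvester operator and its adjoint *)

Section SylvesterOperator.
Variables (R : realType) (M N : nat) (I : 'I_M -> nat) (J : 'I_N -> nat).

Definition sylv (A : tensor R I I) (C : tensor R J J) (X : tensor R I J) :
  tensor R I J := A *E X + X *E C.

Lemma sylv_is_linear A C : linear (sylv A C).
Proof.
move=> a X Y; apply/ffunP => ij; rewrite /sylv /einstein !ffunE.
rewrite scalerDr addrACA; congr (_ + _).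
  rewrite scaler_sumr -big_split; apply: eq_bigr => k _ /=.
  by rewrite !ffunE /GRing.scale /=; ring.
rewrite scaler_sumr -big_split; apply: eq_bigr => k _ /=.
by rewrite !ffunE /GRing.scale /=; ring.
Qed.

HB.instance Definition _ A C :=
  GRing.isLinear.Build R (tensor R I J) (tensor R I J) _ (sylv A C)
    (sylv_is_linear A C).

Lemma sylvD A C : {morph sylv A C : X Y / X + Y}.
Proof. exact: linearD. Qed.

Lemma sylvB A C : {morph sylv A C : X Y / X - Y}.
Proof. exact: linearB. Qed.

Lemma sylvZ A C a : {morph sylv A C : X / a *: X}.
Proof. exact: linearZ. Qed.

Lemma dot_einstein_l (A : tensor R I I) (X Y : tensor R I J) :
  dot (A *E X) Y = dot X (ttr A *E Y).
Proof.
rewrite !dot_pair exchange_big [RHS]exchange_big; apply: eq_bigr => j _ /=.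
under eq_bigr do rewrite ffunE mulr_suml.
under [RHS]eq_bigr do rewrite ffunE mulr_sumr.
rewrite exchange_big; apply: eq_bigr => i _; apply: eq_bigr => k _.
by rewrite ffunE /=; ring.
Qed.

Lemma dot_einstein_r (C : tensor R J J) (X Y : tensor R I J) :
  dot (X *E C) Y = dot X (Y *E ttr C).
Proof.
rewrite !dot_pair; apply: eq_bigr => i _.
under eq_bigr do rewrite ffunE mulr_suml.
under [RHS]eq_bigr do rewrite ffunE mulr_sumr.
rewrite exchange_big; apply: eq_bigr => j _; apply: eq_bigr => k _.
by rewrite ffunE /=; ring.
Qed.

Lemma dot_sylv A C (X Y : tensor R I J) :
  dot (sylv A C X) Y = dot X (sylv (ttr A) (ttr C) Y).
Proof. by rewrite dotDl dotDr dot_einstein_l dot_einstein_r. Qed.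

(** The difference of two solutions is in the kernel of the operator, which is
    orthogonal to the range of the adjoint. *)
Lemma solution_pythagoras A C (E W Z : tensor R I J) :
  let Y := sylv (ttr A) (ttr C) W in
  sylv A C Y = E -> sylv A C Z = E ->
  dot Z Z = dot Y Y + dot (Z - Y) (Z - Y).
Proof.
move=> Y solY solZ.
have orth : dot (Z - Y) Y = 0.
  by rewrite -dot_sylv sylvB solY solZ subrr dot0l.
clearbody Y; have ZE : Z = Z - Y + Y by rewrite subrK.
move: (Z - Y) orth ZE => U orth ->.
by rewrite dotDl !dotDr (dotC Y U) orth addr0 add0r addrC.
Qed.

Lemma range_adjoint_least_norm A C (E W : tensor R I J) :
  let Y := sylv (ttr A) (ttr C) W in
  sylv A C Y = E -> unique (least_norm_solution A C E) Y.
Proof.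
move=> Y solY; split.
  split=> // Z solZ; rewrite ler_fnorm (solution_pythagoras solY solZ).
  by rewrite lerDl dot_ge0.
move=> Z [solZ /(_ Y solY)]; rewrite ler_fnorm (solution_pythagoras solY solZ).
rewrite gerDl => le0.
apply/esym/eqP; rewrite -subr_eq0 -dot_eq0.
by rewrite eq_le le0 dot_ge0.
Qed.

End SylvesterOperator.

(** * Algorithm G *)

Section AlgorithmG.
Variables (R : realType) (M N : nat) (I : 'I_M -> nat) (J : 'I_N -> nat).
Variables (A : tensor R I I) (C : tensor R J J) (E X1 : tensor R I J).

Local Notation L := (sylv A C).
Local Notation Lt := (sylv (ttr A) (ttr C)).

(** The update without the stopping test.  Iterating it gives total sequences,
    which agree with the run of the algorithm up to the stopping time; later
    terms may involve quotients by zero, which are zero by convention. *)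
Definition algG_next (s : algG_state R I J) : algG_state R I J :=
  let: AlgGState Xk Rk Pk := s in
  let X' := Xk + (fnorm Rk ^+ 2 / fnorm Pk ^+ 2) *: Pk in
  let R' := E - A *E X' - X' *E C in
  AlgGState X' R' (ttr A *E R' + R' *E ttr C
                   + (fnorm R' ^+ 2 / fnorm Rk ^+ 2) *: Pk).

Definition state k := iter k algG_next (algG_init A C E X1).
Definition Xs k := stX (state k).
Definition Rs k := stR (state k).
Definition Ps k := stP (state k).
Definition alpha k : R := dot (Rs k) (Rs k) / dot (Ps k) (Ps k).
Definition beta k : R := dot (Rs k.+1) (Rs k.+1) / dot (Rs k) (Rs k).

Lemma XsS k : Xs k.+1 = Xs k + alpha k *: Ps k.
Proof.
rewrite /Xs /alpha /Rs /Ps /= -/(state k).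
by case: (state k) => X Rk P /=; rewrite !fnorm_sqr.
Qed.

Lemma RsE k : Rs k = E - L (Xs k).
Proof.
case: k => [|k]; rewrite /Rs /Xs /sylv opprD addrA //=.
by rewrite -/(state k); case: (state k).
Qed.

Lemma RsS k : Rs k.+1 = Rs k - alpha k *: L (Ps k).
Proof. by rewrite !RsE XsS sylvD sylvZ opprD addrA. Qed.

Lemma Ps0 : Ps 0 = Lt (Rs 0).
Proof. by []. Qed.

Lemma PsS k : Ps k.+1 = Lt (Rs k.+1) + beta k *: Ps k.
Proof.
rewrite /beta /Rs /Ps /= -/(state k).
by case: (state k) => X Rk P /=; rewrite !fnorm_sqr.
Qed.

(** A direction is never zero before the residual is, because its inner product
    with the error recovers the squared norm of the residual. *)
Lemma dot_error_direction X' k :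
  L X' = E -> dot (X' - Xs k) (Ps k) = dot (Rs k) (Rs k).
Proof.
move=> solX'.
have dot_Lt j : dot (X' - Xs j) (Lt (Rs j)) = dot (Rs j) (Rs j).
  by rewrite -dot_sylv sylvB solX' -RsE.
elim: k => [|k IHk]; first by rewrite Ps0 dot_Lt.
rewrite PsS dotDr dot_Lt dotZr XsS opprD addrA dotBl IHk dotZl /alpha.
case: (eqVneq (dot (Ps k) (Ps k)) 0) => [|dP_neq0].
  move/eqP; rewrite dot_eq0 => /eqP Pk0.
  by rewrite -IHk Pk0 !dot0r mulr0 subrr mulr0 addr0.
by rewrite divfK // subrr mulr0 addr0.
Qed.

Lemma direction_neq0 X' k : L X' = E -> Rs k != 0 -> Ps k != 0.
Proof.
move=> solX'; apply: contra => /eqP Pk0.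
by rewrite -dot_eq0 -(dot_error_direction k solX') Pk0 dot0r.
Qed.

Lemma algG_run_state X' k :
  L X' = E -> (forall i, (i < k)%N -> Rs i != 0) ->
  algG_run A C E X1 k = Some (state k).
Proof.
move=> solX'; elim: k => [//|k IHk] R_neq0 /=.
rewrite IHk => [/=|i ltik]; last by apply: R_neq0; apply: ltnW.
have Rk_neq0 := R_neq0 k (ltnSn k).
have := direction_neq0 solX' Rk_neq0; move: Rk_neq0.
rewrite /Rs /Ps /algG_step -/(state k).
by case: (state k) => X Rk P /= /negPf -> /negPf ->.
Qed.

(** The usual simultaneous induction for conjugate gradients: the new residual
    is orthogonal to the old ones because Lt (R_i) is a combination of P_i and
    P_(i-1); the new direction is orthogonal to the old ones because L (P_i) is
    a multiple of R_i - R_(i+1).  The coefficients alpha and beta are exactly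
    those that give orthogonality to the immediate predecessor. *)
Lemma residuals_directions_orthogonal X' k :
  L X' = E -> (forall i, (i < k)%N -> Rs i != 0) ->
  forall i j, (i < j)%N -> (j <= k)%N ->
    dot (Rs j) (Rs i) = 0 /\ dot (Ps j) (Ps i) = 0.
Proof.
move=> solX'; elim: k => [|k IHk] R_neq0 i j ltij lejk.
  by move: (leq_trans ltij lejk).
have {}IHk : forall i j, (i < j)%N -> (j <= k)%N ->
    dot (Rs j) (Rs i) = 0 /\ dot (Ps j) (Ps i) = 0.
  by apply: IHk => m ltmk; apply: R_neq0; apply: ltnW.
have dR_neq0 m : (m <= k)%N -> dot (Rs m) (Rs m) != 0.
  by move=> lemk; rewrite dot_eq0 R_neq0.
have dP_neq0 m : (m <= k)%N -> dot (Ps m) (Ps m) != 0.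
  by move=> lemk; rewrite dot_eq0 (direction_neq0 solX') ?R_neq0.
have dot_Pk_Lt m : (m <= k)%N -> dot (Ps k) (Lt (Rs m)) = dot (Ps k) (Ps m).
  case: m => [|m] lemk; first by rewrite Ps0.
  by rewrite [Ps m.+1]PsS dotDr dotZr (IHk m k _ _).2 // mulr0 addr0.
have orthR m : (m <= k)%N -> dot (Rs k.+1) (Rs m) = 0.
  move=> lemk; rewrite RsS dotBl dotZl dot_sylv dot_Pk_Lt //.
  move: lemk; rewrite leq_eqVlt => /predU1P[->|ltmk].
    by rewrite /alpha divfK ?subrr // dP_neq0.
  by have [-> ->] := IHk m k ltmk (leqnn k); rewrite mulr0 subr0.
have alpha_neq0 m : (m <= k)%N -> alpha m != 0.
  by move=> lemk; rewrite mulf_neq0 ?invr_neq0 ?dR_neq0 ?dP_neq0.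
have L_Ps m : (m <= k)%N -> L (Ps m) = (alpha m)^-1 *: (Rs m - Rs m.+1).
  move=> lemk; rewrite RsS opprB addrC subrK scalerA.
  by rewrite mulVf ?scale1r ?alpha_neq0.
have orthP m : (m <= k)%N -> dot (Ps k.+1) (Ps m) = 0.
  move=> lemk; rewrite PsS dotDl dotZl (dotC (Lt _)) -dot_sylv.
  rewrite L_Ps // dotZl dotBl (dotC (Rs m)) orthR // sub0r.
  move: lemk; rewrite leq_eqVlt => /predU1P[->|ltmk].
    by rewrite /alpha /beta invf_div; ring.
  by rewrite (dotC (Rs m.+1)) orthR // (IHk m k _ _).2 // oppr0 !mulr0 addr0.
move: lejk; rewrite leq_eqVlt => /predU1P[ejk|]; last exact: IHk.
by move: ltij; rewrite ejk ltnS => leik; split; [apply: orthR | apply: orthP].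
Qed.

Lemma residual_vanishes X' : L X' = E -> exists k, Rs k == 0.
Proof.
move=> solX'; pose n := #|{: midx I * midx J}|.
have [/existsP[k Rk0]|/existsPn R_neq0] :=
  boolP [exists k : 'I_n.+1, Rs k == 0]; first by exists k.
have orth (i j : 'I_n.+1) : (i < j)%N -> dot (Rs j) (Rs i) = 0.
  move=> ltij; have lejn : (j <= n)%N by rewrite -ltnS.
  apply: (residuals_directions_orthogonal solX' _ ltij lejn).1 => m ltmn.
  exact: (R_neq0 (Ordinal (leq_trans ltmn (leqnSn n)))).
have : (n.+1 <= n)%N; last by rewrite ltnn.
apply: (orthogonal_family_bound (f := fun i : 'I_n.+1 => Rs i)) => // i j.
by rewrite neq_ltn => /orP[] /orth //; rewrite dotC.
Qed.

Lemma iterate_in_range W k : X1 = Lt W ->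
  exists V U, Xs k = Lt V /\ Ps k = Lt U.
Proof.
move=> X1E; elim: k => [|k [V [U [XE PE]]]].
  by exists W, (Rs 0); rewrite Ps0.
exists (V + alpha k *: U), (Rs k.+1 + beta k *: U).
by rewrite XsS PsS XE PE !sylvD !sylvZ.
Qed.

Lemma algG_obtains_range X' W : L X' = E -> X1 = Lt W ->
  exists V, L (Lt V) = E /\ algG_obtains A C E X1 (Lt V).
Proof.
move=> solX' X1E; have exR := residual_vanishes solX'.
case: (ex_minnP exR) => k /eqP Rk0 min_k.
have [V [_ [XkE _]]] := iterate_in_range k X1E.
exists V; split.
  by apply/esym/eqP; rewrite -subr_eq0 -XkE -RsE Rk0.
exists k, (state k); split=> //.
apply: (algG_run_state solX') => i ltik.
by apply: contraL ltik => /min_k; rewrite -leqNgt.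
Qed.

End AlgorithmG.

(** * The nearness problem *)

(** Translation by X0 turns the nearness problem into the least norm problem for
    the shifted right-hand side. *)
Lemma nearness_shift (R : realType) (M N : nat)
    (I : 'I_M -> nat) (J : 'I_N -> nat)
    (A : tensor R I I) (C : tensor R J J) (D X0 Y : tensor R I J) :
  nearness_solution A C D X0 (Y + X0) <->
  least_norm_solution A C (D - A *E X0 - X0 *E C) Y.
Proof.
have shift Z : sylvester_solution A C D (Z + X0) <->
    sylvester_solution A C (D - A *E X0 - X0 *E C) Z.
  have -> : D - A *E X0 - X0 *E C = D - sylv A C X0.
    by rewrite [in RHS]/sylv opprD addrA.
  rewrite /sylvester_solution -!/(sylv A C _) sylvD.
  split=> [<-|->]; first by rewrite addrK.
  by rewrite subrK.
split=> -[/shift solY minY]; split=> // Z.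
  by move=> /shift /minY; rewrite !addrK.
by rewrite -{1}(subrK X0 Z) => /shift /minY; rewrite addrK.
Qed.

Theorem mainTheorem4 (R : realType) (M N : nat)
    (I : 'I_M -> nat) (J : 'I_N -> nat)
    (A : tensor R I I) (C : tensor R J J) (D X0 : tensor R I J) :
  (exists X : tensor R I J, sylvester_solution A C D X) ->
  let Dt : tensor R I J := D - A *E X0 - X0 *E C in
  exists Xhat Yhat : tensor R I J,
    [/\ unique (nearness_solution A C D X0) Xhat,
        unique (least_norm_solution A C Dt) Yhat,
        Xhat = Yhat + X0,
        forall W : tensor R I J,
          algG_obtains A C Dt (ttr A *E W + W *E ttr C) Yhat
      & algG_obtains A C Dt 0 Yhat].
Proof.
move=> [X solX] Dt.
have solX' : sylv A C (X - X0) = Dt.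
  by rewrite sylvB {1}/sylv solX /Dt /sylv opprD addrA.
have zeroE : 0 = sylv (ttr A) (ttr C) (0 : tensor R I J) by rewrite linear0.
have [V [solV obtV]] := algG_obtains_range solX' zeroE.
set Y := sylv (ttr A) (ttr C) V in solV obtV.
have uniqY : unique (least_norm_solution A C Dt) Y.
  exact: range_adjoint_least_norm solV.
exists (Y + X0), Y; split=> //.
- split; first by apply/nearness_shift; case: uniqY.
  move=> Z; rewrite -{1}(subrK X0 Z) => /nearness_shift.
  by case: uniqY => _ uY /uY ->; rewrite subrK.
- move=> W; have [V' [solV' obtV']] :=
    algG_obtains_range solX' (erefl (sylv (ttr A) (ttr C) W)).
  case: uniqY => _ uY.
  by rewrite (uY _ (range_adjoint_least_norm solV').1).
Qed.
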